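(* Let $\mathcal G$ be a finite-dimensional Lie algebra over an algebraically closed field of characteristic $0$. Let $\mathbf A$ be the collection of all bijective 1-cocycles $(f,q)$ of $\mathcal G$, and let $\mathbf B$ be the set of all left-symmetric algebra structures on $\mathcal G$. Let $\Phi:\mathbf A\to\mathbf B$ send $(f,q)$ to the product $x*y=q^{-1}(f(x)q(y))$, $x,y\in\mathcal G$, and let $\Psi:\mathbf B\to\mathbf A$ send a left-symmetric algebra structure on $\mathcal G$ to $(L,\mathrm{id})$. Then $\Phi$ and $\Psi$ induce a bijection between the set of isomorphism classes of bijective 1-cocycles of $\mathcal G$ and the set of left-symmetric algebras on $\mathcal G$. Under this correspondence equivalent bijective 1-cocycles are mapped to isomorphic left-symmetric algebras and vice versa. That is, $\mathbf A/{\cong}\longleftrightarrow\mathbf B$ and $\mathbf A/{\sim}\longleftrightarrow\mathbf B/{\cong}$.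
   Context: A left-symmetric algebra is a vector space $A$ with a bilinear product such that $(xy)z-x(yz)=(yx)z-y(xz)$ for all $x,y,z\in A$. The commutator $[x,y]=xy-yx$ is then a Lie bracket. A left-symmetric algebra structure on a Lie algebra $\mathcal G$ (an element of $\mathbf B$) is a left-symmetric product on the vector space $\mathcal G$ whose commutator is the Lie bracket of $\mathcal G$; $L:\mathcal G\to gl(\mathcal G)$, $L_x(y)=xy$, is then a representation of $\mathcal G$. Two left-symmetric algebras are isomorphic ($\cong$) if there is a linear isomorphism between them preserving the products. For a representation $f:\mathcal G\to gl(V)$, a 1-cocycle associated to $f$ is a linear map $q:\mathcal G\to V$ with $q([x,y])=f(x)q(y)-f(y)q(x)$ for all $x,y\in\mathcal G$; it is denoted $(f,q)$ and is called bijective if $q$ is a linear isomorphism. Two bijective 1-cocycles $(f_1,q_1)$ (on $V_1$) and $(f_2,q_2)$ (on $V_2$) are isomorphic ($\cong$) if there is a linear isomorphism $g:V_1\to V_2$ with $f_2(x)=g f_1(x) g^{-1}$ for all $x\in\mathcal G$ and $q_2=g q_1$. They are equivalent ($\sim$) if there are a linear isomorphism $g:V_1\to V_2$ and a Lie algebra automorphism $T$ of $\mathcal G$ with $f_2(x)=g f_1(T(x)) g^{-1}$ for all $x$ and $q_2=g q_1 T$. *)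

(* Defs.v *)
From HB Require Import structures.
From mathcomp Require Import all_boot all_order all_algebra.
From Corelib Require Import RelationClasses.

Set Implicit Arguments.
Unset Strict Implicit.
Unset Printing Implicit Defensive.

Import GRing.Theory.
Local Open Scope ring_scope.

HB.mixin Record Vector_isLie (F : fieldType) (G : Type) of Vector F G := {
  lie : G -> G -> G;
  lie_linearl : forall (a : F) (x y z : G),
    lie (a *: x + y) z = a *: lie x z + lie y z;
  lie_linearr : forall (a : F) (x y z : G),
    lie x (a *: y + z) = a *: lie x y + lie x z;
  liexx : forall x : G, lie x x = 0;
  lie_jacobi : forall x y z : G,
    lie x (lie y z) + lie y (lie z x) + lie z (lie x y) = 0
}.

#[short(type="lieAlgType")]
HB.structure Definition LieAlg (F : fieldType) :=
  { G of Vector_isLie F G & Vector F G }.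

Section LeftSymmetric.
Variable F : fieldType.

(* A bilinear product on [A] is encoded as a linear map [m : A -> End(A)], the
   product of [x] and [y] being [m x y]; so [m] is the map [x |-> L_x]. *)
Definition left_symmetric (A : vectType F) (m : 'Hom(A, 'End(A))) : Prop :=
  forall x y z : A, m (m x y) z - m x (m y z) = m (m y x) z - m y (m x z).

Definition product_iso (A1 A2 : vectType F)
    (m1 : 'Hom(A1, 'End(A1))) (m2 : 'Hom(A2, 'End(A2))) : Prop :=
  exists g : 'Hom(A1, A2),
    bijective g /\ forall x y : A1, g (m1 x y) = m2 (g x) (g y).

Record lsa (G : lieAlgType F) := LSA {
  lsa_mul :> 'Hom(G, 'End(G));
  lsaP : left_symmetric lsa_mul;
  lsa_lie : forall x y : G, lsa_mul x y - lsa_mul y x = lie x y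
}.

Definition lsa_iso (G : lieAlgType F) (b1 b2 : lsa G) : Prop :=
  product_iso b1 b2.

End LeftSymmetric.

Section Cocycles.
Variables (F : fieldType) (G : lieAlgType F).

Definition representation (V : vectType F) (f : 'Hom(G, 'End(V))) : Prop :=
  forall x y : G, f (lie x y) = (f x \o f y)%VF - (f y \o f x)%VF.

Definition cocycle1 (V : vectType F) (f : 'Hom(G, 'End(V))) (q : 'Hom(G, V)) :
    Prop :=
  forall x y : G, q (lie x y) = f x (q y) - f y (q x).

(* Restricting to finite-dimensional [V] is harmless: [cocycle_map] is a linear
   isomorphism from the finite-dimensional [G] onto [V]. *)
Record bij_cocycle := BijCocycle {
  cocycle_space : vectType F;
  cocycle_rep : 'Hom(G, 'End(cocycle_space));
  cocycle_map : 'Hom(G, cocycle_space);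
  cocycle_repP : representation cocycle_rep;
  cocycle_mapP : cocycle1 cocycle_rep cocycle_map;
  cocycle_bij : bijective cocycle_map
}.

Definition cocycle_iso (c1 c2 : bij_cocycle) : Prop :=
  exists g : 'Hom(cocycle_space c1, cocycle_space c2),
    [/\ bijective g,
        forall x : G, cocycle_rep c2 x = (g \o cocycle_rep c1 x \o g^-1)%VF
      & cocycle_map c2 = (g \o cocycle_map c1)%VF].

Definition lie_automorphism (T : 'End(G)) : Prop :=
  bijective T /\ forall x y : G, T (lie x y) = lie (T x) (T y).

Definition cocycle_equiv (c1 c2 : bij_cocycle) : Prop :=
  exists (g : 'Hom(cocycle_space c1, cocycle_space c2)) (T : 'End(G)),
    [/\ bijective g,
        lie_automorphism T,
        forall x : G, cocycle_rep c2 x = (g \o cocycle_rep c1 (T x) \o g^-1)%VF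
      & cocycle_map c2 = (g \o cocycle_map c1 \o T)%VF].

End Cocycles.

Section Lfun.
Variable F : fieldType.

Lemma lfun_bijK (U V : vectType F) (g : 'Hom(U, V)) :
  bijective g -> cancel g (g^-1)%VF.
Proof. by move=> /bij_inj/lker0P; apply: lker0_lfunK. Qed.

Lemma lfun_bijVK (U V : vectType F) (g : 'Hom(U, V)) :
  bijective g -> cancel (g^-1)%VF g.
Proof.
move=> gB y; apply: limg_lfunVK; case: gB => h _ hK.
by rewrite -(hK y) memv_img ?memvf.
Qed.

Lemma lfun_bijV (U V : vectType F) (g : 'Hom(U, V)) :
  bijective g -> bijective (g^-1)%VF.
Proof. by move=> gB; exists g; [apply: lfun_bijVK | apply: lfun_bijK]. Qed.

Lemma lfun_bij_comp (U V W : vectType F) (h : 'Hom(V, W)) (g : 'Hom(U, V)) :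
  bijective h -> bijective g -> bijective (h \o g)%VF.
Proof.
move=> hB gB; apply: eq_bij (bij_comp hB gB) _ _ => x.
by rewrite comp_lfunE.
Qed.

Lemma lfun_bij1 (U : vectType F) : bijective (\1%VF : 'End(U)).
Proof. by exists id => x; rewrite id_lfunE. Qed.

Lemma lfun_bijVV (U V : vectType F) (g : 'Hom(U, V)) :
  bijective g -> ((g^-1)^-1)%VF = g.
Proof.
move=> gB; apply/lfunP => x; have gVB := lfun_bijV gB.
by apply: (bij_inj gVB); rewrite lfun_bijVK ?lfun_bijK.
Qed.

Lemma lfun_bij_compV (U V W : vectType F) (h : 'Hom(V, W)) (g : 'Hom(U, V)) :
  bijective h -> bijective g -> ((h \o g)^-1 = g^-1 \o h^-1)%VF.
Proof.
move=> hB gB; apply/lfunP => x; have B := lfun_bij_comp hB gB.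
by apply: (bij_inj B); rewrite lfun_bijVK // !comp_lfunE !lfun_bijVK.
Qed.

End Lfun.

Lemma sub_lfunE (F : fieldType) (U V : vectType F) (f g : 'Hom(U, V)) (x : U) :
  (f - g) x = f x - g x.
Proof. by rewrite add_lfunE opp_lfunE. Qed.

Section PhiPsi.
Variables (F : fieldType) (G : lieAlgType F).

Definition Phi_mul (c : bij_cocycle G) : 'Hom(G, 'End(G)) :=
  linfun (fun x : G =>
    ((cocycle_map c)^-1 \o cocycle_rep c x \o cocycle_map c)%VF).

Lemma Phi_mulE (c : bij_cocycle G) (x y : G) :
  Phi_mul c x y = (cocycle_map c)^-1%VF (cocycle_rep c x (cocycle_map c y)).
Proof.
pose h x := ((cocycle_map c)^-1 \o cocycle_rep c x \o cocycle_map c)%VF.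
have hL : linear h.
  move=> a u v; apply/lfunP => w.
  by rewrite /h add_lfunE scale_lfunE !comp_lfunE linearP add_lfunE scale_lfunE
             linearP.
pose hLin := GRing.isLinear.Build _ _ _ _ h hL.
pose hl : {linear G -> 'End(G)} := HB.pack h hLin.
by rewrite /Phi_mul -/h (lfunE hl) /= !comp_lfunE.
Qed.

Lemma Phi_lie (c : bij_cocycle G) (x y : G) :
  Phi_mul c x y - Phi_mul c y x = lie x y.
Proof.
rewrite !Phi_mulE -linearB -cocycle_mapP.
exact: (lfun_bijK (cocycle_bij c)).
Qed.

Lemma sub_exchange (V : zmodType) (a b c d : V) :
  a - b = c - d -> a - c = b - d.
Proof.
move=> /(canRL (subrK b)) ->.
by rewrite addrAC [c - d - c]addrAC subrr add0r addrC.
Qed.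

Lemma Phi_left_symmetric (c : bij_cocycle G) : left_symmetric (Phi_mul c).
Proof.
move=> x y z; apply: sub_exchange.
rewrite -sub_lfunE -linearB Phi_lie !Phi_mulE.
have qB := cocycle_bij c.
by rewrite !(lfun_bijVK qB) cocycle_repP sub_lfunE !comp_lfunE linearB.
Qed.

(* [Phi_mulE] gives x * y = q^-1 (f x (q y)). *)
Definition Phi (c : bij_cocycle G) : lsa G :=
  LSA (@Phi_left_symmetric c) (Phi_lie c).

Lemma lsa_representation (b : lsa G) : representation (lsa_mul b).
Proof.
move=> x y; apply/lfunP => z.
rewrite -(lsa_lie b) linearB !sub_lfunE !comp_lfunE.
exact/sub_exchange/lsaP.
Qed.

Lemma lsa_cocycle (b : lsa G) : cocycle1 (lsa_mul b) \1%VF.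
Proof. by move=> x y; rewrite !id_lfunE lsa_lie. Qed.

Definition Psi (b : lsa G) : bij_cocycle G :=
  BijCocycle (@lsa_representation b) (@lsa_cocycle b) (lfun_bij1 G).

End PhiPsi.

Section Quotient.

Definition classes (T : Type) (E : T -> T -> Prop) : Type :=
  {P : T -> Prop | exists a : T, P = E a}.

Definition class_of (T : Type) (E : T -> T -> Prop) (a : T) : classes E :=
  exist _ (E a) (ex_intro _ a erefl).

Variables (F : fieldType) (G : lieAlgType F).

Lemma lsa_iso_equivalence : Equivalence (@lsa_iso F G).
Proof.
split.
- by move=> b; exists \1%VF; split=> [|x y]; [exact: lfun_bij1 | rewrite !id_lfunE].
- move=> b1 b2 [g [gB gM]]; exists (g^-1)%VF.
  split=> [|x y]; first exact: lfun_bijV.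
  by apply: (bij_inj gB); rewrite gM !lfun_bijVK.
- move=> b1 b2 b3 [g [gB gM]] [h [hB hM]]; exists (h \o g)%VF.
  split=> [|x y]; first exact: lfun_bij_comp.
  by rewrite !comp_lfunE gM hM.
Qed.

Lemma cocycle_equiv_equivalence : Equivalence (@cocycle_equiv F G).
Proof.
split.
- move=> c; exists \1%VF, \1%VF; split; first exact: lfun_bij1.
  + by split=> [|x y]; [exact: lfun_bij1 | rewrite !id_lfunE].
  + move=> x; rewrite id_lfunE comp_lfun1l; apply/lfunP => y.
    by rewrite comp_lfunE -[(_^-1)%VF y]id_lfunE (lfun_bijVK (lfun_bij1 _)).
  + by rewrite comp_lfun1l comp_lfun1r.
- move=> c1 c2 [g [T [gB [TB TM] fE qE]]]; exists (g^-1)%VF, (T^-1)%VF.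
  have TVB := lfun_bijV TB; split; first exact: lfun_bijV.
  + by split=> // x y; apply: (bij_inj TB); rewrite TM !lfun_bijVK.
  + move=> x; apply/lfunP => y.
    by rewrite fE lfun_bijVV // !comp_lfunE !lfun_bijVK ?lfun_bijK.
  + by apply/lfunP => y; rewrite qE !comp_lfunE lfun_bijVK ?lfun_bijK.
- move=> c1 c2 c3 [g [T [gB [TB TM] fE qE]]] [h [U [hB [UB UM] f'E q'E]]].
  exists (h \o g)%VF, (T \o U)%VF; split; first exact: lfun_bij_comp.
  + split=> [|x y]; first exact: lfun_bij_comp.
    by rewrite !comp_lfunE UM TM.
  + move=> x; rewrite f'E fE lfun_bij_compV //.
    by apply/lfunP => y; rewrite !comp_lfunE.
  + by rewrite q'E qE; apply/lfunP => y; rewrite !comp_lfunE.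
Qed.

Lemma cocycle_iso_equivalence : Equivalence (@cocycle_iso F G).
Proof.
split.
- move=> c; exists \1%VF; split; first exact: lfun_bij1.
  + move=> x; rewrite comp_lfun1l; apply/lfunP => y.
    by rewrite comp_lfunE -[(_^-1)%VF y]id_lfunE (lfun_bijVK (lfun_bij1 _)).
  + by rewrite comp_lfun1l.
- move=> c1 c2 [g [gB fE qE]]; exists (g^-1)%VF; split; first exact: lfun_bijV.
  + move=> x; apply/lfunP => y.
    by rewrite fE lfun_bijVV // !comp_lfunE !lfun_bijK.
  + by apply/lfunP => y; rewrite qE !comp_lfunE lfun_bijK.
- move=> c1 c2 c3 [g [gB fE qE]] [h [hB f'E q'E]].
  exists (h \o g)%VF; split; first exact: lfun_bij_comp.
  + move=> x; rewrite f'E fE lfun_bij_compV //.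
    by apply/lfunP => y; rewrite !comp_lfunE.
  + by rewrite q'E qE comp_lfunA.
Qed.

End Quotient.

(* Main.v *)
Require Import Defs.
From HB Require Import structures.
From mathcomp Require Import all_boot all_order all_algebra.
From mathcomp Require Import boolp.
From Corelib Require Import RelationClasses.

Import GRing.Theory.
Local Open Scope ring_scope.

(** The map [q] of a bijective 1-cocycle [c = (f, q)] is an isomorphism from
    [c] to [(L, id)], where [L] is the left multiplication of [Phi c]: by
    definition [L x] is [f x] conjugated by [q].  Hence [Psi (Phi c)] is
    isomorphic to [c], while [Phi (Psi b) = b] holds by computation.  Since
    [Phi] is constant on isomorphism classes, this is the first bijection.

    For the second one, [(g, T)] is an equivalence from [(f1, q1)] to [(f2, q2)]
    exactly when [T] is an isomorphism from the product of [(f2, q2)] to that of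
    [(f1, q1)] and [g = q2 T^-1 q1^-1]: given [q2 = g q1 T], the condition
    [f2 x = g (f1 (T x)) g^-1], evaluated at [q2 y], says
    [T (x * y) = T x * T y].  Such a [T] preserves commutators, so it is
    automatically a Lie automorphism.  Thus [Phi] preserves and reflects the two
    equivalence relations ([cocycle_equiv_Phi]), and [Phi] and [Psi] are
    mutually inverse on the quotients. *)

Section Classes.
Set Implicit Arguments.
Unset Strict Implicit.

Lemma class_of_surj (T : Type) (E : T -> T -> Prop) (k : classes E) :
  exists a, k = class_of E a.
Proof.
by case: k => P [a Pa]; exists a; apply: eq_exist.
Qed.

Lemma class_ofP (T : Type) (E : T -> T -> Prop) (EE : Equivalence E) (a b : T) :
  class_of E a = class_of E b <-> E a b.
Proof.
split=> [/(congr1 (@proj1_sig _ _)) /= Eab | Eab].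
  by rewrite Eab; reflexivity.
apply: eq_exist; apply/funext => c; apply/propext.
by split=> Ec; [transitivity a; first symmetry | transitivity b].
Qed.

(** Universal property of the quotient: a map constant on classes factors
    through it.  The factorization is computed on chosen representatives. *)
Lemma class_lift (T U : Type) (E : T -> T -> Prop) (EE : Equivalence E)
    (f : T -> U) :
  (forall a b, E a b -> f a = f b) ->
  exists phi : classes E -> U, forall a, phi (class_of E a) = f a.
Proof.
move=> fE; have [r rK] := choice (@class_of_surj T E).
exists (fun k => f (r k)) => a.
by apply/esym/fE/(class_ofP EE)/rK.
Qed.

End Classes.

Section PhiPsiTheory.
Set Implicit Arguments.
Unset Strict Implicit.
Variables (F : fieldType) (G : lieAlgType F).
Implicit Types (b : lsa G) (c : bij_cocycle G).

Lemma lsa_eq b1 b2 : (forall x y : G, b1 x y = b2 x y) -> b1 = b2.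
Proof.
case: b1 b2 => [m1 S1 L1] [m2 S2 L2] /= m12.
have m_eq : m1 = m2 by apply/lfunP => x; apply/lfunP => y; apply: m12.
case: _ / m_eq S2 L2 {m12} => S2 L2.
by congr LSA; apply: Prop_irrelevance.
Qed.

Lemma cocycle_map_Phi c (x y : G) :
  cocycle_map c (Phi c x y) = cocycle_rep c x (cocycle_map c y).
Proof. by rewrite /= Phi_mulE (lfun_bijVK (cocycle_bij c)). Qed.

Lemma Phi_cocycle_iso c1 c2 : cocycle_iso c1 c2 -> Phi c1 = Phi c2.
Proof.
move=> [g [gB fE qE]]; apply: lsa_eq => x y.
apply: (bij_inj (cocycle_bij c2)).
rewrite cocycle_map_Phi fE qE !comp_lfunE (lfun_bijK gB).
by rewrite cocycle_map_Phi.
Qed.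

Lemma PsiK b : Phi (Psi b) = b.
Proof.
apply: lsa_eq => x y; apply: (bij_inj (cocycle_bij (Psi b))).
by rewrite cocycle_map_Phi /= !id_lfunE.
Qed.

Lemma Psi_Phi_iso c : cocycle_iso (Psi (Phi c)) c.
Proof.
have qB := cocycle_bij c.
exists (cocycle_map c); split=> //; last by rewrite comp_lfun1r.
move=> x; apply/lfunP => v.
by rewrite !comp_lfunE cocycle_map_Phi (lfun_bijVK qB).
Qed.

Lemma cocycle_iso_equiv c1 c2 : cocycle_iso c1 c2 -> cocycle_equiv c1 c2.
Proof.
move=> [g [gB fE qE]]; exists g, \1%VF; split=> //.
- by split=> [|x y]; [exact: lfun_bij1 | rewrite !id_lfunE].
- by move=> x; rewrite id_lfunE.
- by rewrite comp_lfun1r.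
Qed.

(** A multiplicative linear map preserves commutators, hence the Lie bracket. *)
Lemma lsa_iso_lie b1 b2 (T : 'End(G)) :
  (forall x y : G, T (b1 x y) = b2 (T x) (T y)) ->
  forall x y : G, T (lie x y) = lie (T x) (T y).
Proof.
move=> TM x y.
by rewrite -(lsa_lie b1 x) -(lsa_lie b2 (T x)) linearB /= !TM.
Qed.

Lemma cocycle_equiv_Phi c1 c2 :
  cocycle_equiv c1 c2 <-> lsa_iso (Phi c1) (Phi c2).
Proof.
have q1B := cocycle_bij c1; have q2B := cocycle_bij c2.
have lsa_isoC := @Equivalence_Symmetric _ _ (lsa_iso_equivalence G).
(* The automorphism of an equivalence from c1 to c2 maps Phi c2 to Phi c1. *)
split=> [[g [T [gB [TB _] fE qE]]] | /lsa_isoC [T [TB TM]]].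
  apply: lsa_isoC; exists T; split=> // x y.
  have gqB := lfun_bij_comp gB q1B.
  apply: (bij_inj gqB); rewrite -comp_lfunE -qE cocycle_map_Phi fE qE.
  by rewrite !comp_lfunE (lfun_bijK gB) cocycle_map_Phi.
have [g gB qE] : exists2 g : 'Hom(cocycle_space c1, cocycle_space c2),
    bijective g & cocycle_map c2 = (g \o cocycle_map c1 \o T)%VF.
  exists (cocycle_map c2 \o T^-1 \o (cocycle_map c1)^-1)%VF.
    apply: lfun_bij_comp (lfun_bijV q1B).
    exact: lfun_bij_comp (lfun_bijV TB).
  by apply/lfunP => x; rewrite !comp_lfunE (lfun_bijK q1B) (lfun_bijK TB).
exists g, T; split=> //; first by split=> //; apply: lsa_iso_lie TM.
move=> x; apply/lfunP => v; rewrite -[v](lfun_bijVK q2B).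
rewrite -cocycle_map_Phi qE !comp_lfunE (lfun_bijK gB).
by rewrite TM cocycle_map_Phi.
Qed.

End PhiPsiTheory.

Theorem theorem2p1 (F : closedFieldType) (F0 : [pchar F] =i pred0)
    (G : lieAlgType F) :
  (* A/iso <-> B, induced by Phi and Psi *)
  (exists (phi : classes (@cocycle_iso F G) -> lsa G)
          (psi : lsa G -> classes (@cocycle_iso F G)),
     [/\ forall c : bij_cocycle G, phi (class_of (@cocycle_iso F G) c) = Phi c,
         forall b : lsa G, psi b = class_of (@cocycle_iso F G) (Psi b),
         cancel phi psi
       & cancel psi phi]) /\
  (* equivalent cocycles correspond to isomorphic left-symmetric algebras *)
  (forall c1 c2 : bij_cocycle G,
     cocycle_equiv c1 c2 <-> lsa_iso (Phi c1) (Phi c2)) /\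
  (forall b1 b2 : lsa G,
     lsa_iso b1 b2 <-> cocycle_equiv (Psi b1) (Psi b2)) /\
  (* A/equiv <-> B/iso, induced by Phi and Psi *)
  (exists (phi : classes (@cocycle_equiv F G) -> classes (@lsa_iso F G))
          (psi : classes (@lsa_iso F G) -> classes (@cocycle_equiv F G)),
     [/\ forall c : bij_cocycle G,
           phi (class_of (@cocycle_equiv F G) c)
           = class_of (@lsa_iso F G) (Phi c),
         forall b : lsa G,
           psi (class_of (@lsa_iso F G) b)
           = class_of (@cocycle_equiv F G) (Psi b),
         cancel phi psi
       & cancel psi phi]).
Proof.
have isoE := cocycle_iso_equivalence G.
have equivE := cocycle_equiv_equivalence G.
have lsaE := lsa_iso_equivalence G.
have PhiP := @cocycle_equiv_Phi F G.
have PsiP (b1 b2 : lsa G) : lsa_iso b1 b2 <-> cocycle_equiv (Psi b1) (Psi b2).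
  by rewrite PhiP !PsiK.
split; last (split=> //; split=> //).
  have [phi phiE] := class_lift isoE (@Phi_cocycle_iso F G).
  exists phi, (fun b => class_of _ (Psi b)); split=> // [k | b].
    have [c ->] := class_of_surj k.
    by rewrite phiE; apply/(class_ofP isoE)/Psi_Phi_iso.
  by rewrite phiE PsiK.
have PhiE (c1 c2 : bij_cocycle G) : cocycle_equiv c1 c2 ->
    class_of (@lsa_iso F G) (Phi c1) = class_of (@lsa_iso F G) (Phi c2).
  by move=> /PhiP /(class_ofP lsaE).
have PsiE (b1 b2 : lsa G) : lsa_iso b1 b2 ->
    class_of (@cocycle_equiv F G) (Psi b1)
    = class_of (@cocycle_equiv F G) (Psi b2).
  by move=> /PsiP /(class_ofP equivE).
have [phi phiE] := class_lift equivE PhiE.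
have [psi psiE] := class_lift lsaE PsiE.
exists phi, psi; split=> // k.
  have [c ->] := class_of_surj k; rewrite phiE psiE.
  by apply/(class_ofP equivE)/cocycle_iso_equiv/Psi_Phi_iso.
by have [b ->] := class_of_surj k; rewrite psiE phiE PsiK.
Qed.
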